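(* Let $G$ be a connected graph with exactly $m$ edges. Then $\sigma_1(G) \ge m$, with equality if and only if $G \in \mathcal{H}$, where $\mathcal{H}$ is the class of good graphs.
   Context: Graphs are finite, simple and undirected, with vertex set $V(G)$ and edge set $E(G)$. For a graph $G$, $\sigma_1(G)$ denotes the number of $1$-nearly independent vertex subsets of $G$, i.e. the number of subsets $I\subseteq V(G)$ such that the subgraph of $G$ induced by $I$ has exactly one edge. $N_G[u]$ denotes the closed neighbourhood of $u$ in $G$ (that is, $u$ together with all its neighbours). An edge $e=uv\in E(G)$ is a good edge if $N_G[u]\cup N_G[v]=V(G)$. A graph $G$ is a good graph if every edge of $G$ is a good edge. $\mathcal{H}$ is the class of all good graphs. *)

(* Defs.v *)
From mathcomp Require Import all_boot.

Set Implicit Arguments.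
Unset Strict Implicit.
Unset Printing Implicit Defensive.

Record sgraph := SGraph {
  vert :> finType;
  adj : rel vert;
  adj_sym : symmetric adj;
  adj_irr : irreflexive adj }.

(* Undirected edges, as two-element sets: the pairs (x, y) and (y, x) yield
   the same element, so #|edges G| counts each edge once. *)
Definition edges (G : sgraph) : {set {set G}} :=
  [set [set x; y] | x in [set: G], y in [set: G] & adj x y].

Definition connected_graph (G : sgraph) : Prop :=
  forall x y : G, connect (@adj G) x y.

Section Induced.
Variables (G : sgraph) (I : {set G}).

Definition induced_adj : rel {x : G | x \in I} :=
  [rel x y | adj (val x) (val y)].

Lemma induced_sym : symmetric induced_adj.
Proof. by move=> x y; apply: adj_sym. Qed.

Lemma induced_irr : irreflexive induced_adj.
Proof. by move=> x; apply: adj_irr. Qed.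

Definition induced : sgraph := SGraph induced_sym induced_irr.
End Induced.

Definition sigma1 (G : sgraph) : nat :=
  #|[set I : {set G} | #|edges (induced I)| == 1]|.

Definition closed_nbhd (G : sgraph) (u : G) : {set G} :=
  u |: [set v | adj u v].

Definition good_edge (G : sgraph) (u v : G) : Prop :=
  adj u v /\ closed_nbhd u :|: closed_nbhd v = [set: G].

Definition good_graph (G : sgraph) : Prop :=
  forall u v : G, adj u v -> good_edge u v.

(* Main.v *)
Require Import Defs.
From mathcomp Require Import all_boot.

(** Every edge, seen as a two-element vertex set, induces exactly one edge, so
    [edges G] is contained in the family counted by [sigma1].  The inclusion is
    strict exactly when some edge [uv] misses a vertex [w] (neither in [N[u]]
    nor in [N[v]]): then [{u, v, w}] induces the single edge [uv], whereas in a
    good graph any third vertex of a set containing [uv] brings a second edge. *)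

Lemma edgesP (G : sgraph) (e : {set G}) :
  reflect (exists x y : G, adj x y /\ e = [set x; y]) (e \in edges G).
Proof.
apply: (iffP imset2P) => [[x y _]|[x [y [xy ->]]]].
  by rewrite !inE => xy ->; exists x, y.
by exists x y; rewrite ?inE.
Qed.

(** Moves the count from the subtype carrying [induced I] to vertices of [G]: taking images under
    the injective [val] turns edges of [induced I] into edges of [G] inside [I]. *)
Lemma induced_one_edgeP (G : sgraph) (I : {set G}) :
  reflect (exists u v : G, [/\ u \in I, v \in I, adj u v &
             forall x y : G, x \in I -> y \in I -> adj x y ->
               [set x; y] = [set u; v]])
          (#|edges (induced I)| == 1).
Proof.
have val2 (x y : induced I) : val @: [set x; y] = [set val x; val y].
  by rewrite imsetU !imset_set1.
apply: (iffP cards1P) => [[e eE]|[u [v [uI vI uv uniq]]]].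
  have /edgesP[u [v [uv def_e]]] : e \in edges (induced I) by rewrite eE set11.
  exists (val u), (val v); split=> [|||x y xI yI xy]; try exact: valP; first by [].
  pose x' : induced I := Sub x xI; pose y' : induced I := Sub y yI.
  have : [set x'; y'] \in edges (induced I) by apply/edgesP; exists x', y'.
  by rewrite eE inE def_e => /eqP/(congr1 (fun A : {set induced I} => val @: A)); rewrite !val2.
pose u' : induced I := Sub u uI; pose v' : induced I := Sub v vI.
exists [set u'; v']; apply/setP=> e; rewrite inE.
apply/edgesP/eqP=> [[x [y [xy ->]]]|->]; last by exists u', v'.
apply: (imset_inj val_inj); rewrite !val2.
by apply: uniq => //; apply: valP.
Qed.

Lemma adj_neq (G : sgraph) (u v : G) : adj u v -> u != v.
Proof. by apply: contraTneq => ->; rewrite adj_irr. Qed.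

Lemma edges_sub_sigma1 (G : sgraph) :
  edges G \subset [set I : {set G} | #|edges (induced I)| == 1].
Proof.
apply/subsetP=> _ /edgesP[u [v [uv ->]]]; rewrite inE.
apply/induced_one_edgeP; exists u, v; rewrite !inE !eqxx orbT; split=> // x y.
rewrite !inE => /orP[]/eqP-> /orP[]/eqP->; rewrite ?adj_irr // => _.
exact: setUC.
Qed.

Lemma good_graphP (G : sgraph) :
  good_graph G <->
  [set I : {set G} | #|edges (induced I)| == 1] \subset edges G.
Proof.
split=> [good|sub u v uv].
  apply/subsetP=> I; rewrite inE => /induced_one_edgeP[u [v [uI vI uv uniq]]].
  apply/edgesP; exists u, v; split=> //; apply/eqP.
  rewrite eqEsubset !subUset !sub1set uI vI !andbT; apply/subsetP=> w wI.
  have [_ /setP/(_ w)] := good u v uv.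
  (* If [w] is adjacent to [u] or [v], that edge lies inside [I], so by [uniq] it equals
     [[set u; v]], which therefore contains [w]. *)
  rewrite !inE => /orP[]/orP[/eqP->|aw]; rewrite ?eqxx ?orbT //.
    by have /setP/(_ w) := uniq _ _ uI wI aw; rewrite !inE eqxx orbT => <-.
  by have /setP/(_ w) := uniq _ _ vI wI aw; rewrite !inE eqxx orbT => <-.
split=> //; apply/setP=> w; rewrite !inE; apply: contraTT isT.
rewrite !negb_or => /andP[/andP[wu uw] /andP[wv vw]].
have /(subsetP sub)/edgesP[x [y [xy E]]] :
    [set u; v; w] \in [set I : {set G} | #|edges (induced I)| == 1].
  rewrite inE; apply/induced_one_edgeP; exists u, v.
  rewrite !inE !eqxx !orbT; split=> // x y.
  (* Of the nine pairs only [(u, v)] and [(v, u)] are adjacent. *)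
  rewrite !inE => /orP[/orP[]|]/eqP-> /orP[/orP[]|]/eqP->;
    rewrite ?adj_irr ?(negPf uw) ?(negPf vw) ?[adj w _]adj_sym
            ?(negPf uw) ?(negPf vw) // => _.
  exact: setUC.
(* By [E] the three-element set equals an edge, which has two elements. *)
have := cards2 x y; rewrite -E setUC cardsU1 cards2 (adj_neq _ _ _ uv) !inE.
by rewrite negb_or wu wv (adj_neq _ _ _ xy).
Qed.

Theorem theorem3 (G : sgraph) (m : nat)
  (hconn : connected_graph G) (hm : #|edges G| = m) :
  m <= sigma1 G /\ (sigma1 G = m <-> good_graph G).
Proof.
rewrite -hm; split; first exact: subset_leq_card (edges_sub_sigma1 G).
(* For nested finite sets, equal cardinality means equality, so only the reverse inclusion is at
   stake. *)
have [_ card_eq] := subset_leqif_cards (edges_sub_sigma1 G).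
split=> [/esym/eqP|/good_graphP sub].
  by rewrite card_eq eqEsubset => /andP[_ /good_graphP].
by apply/esym/eqP; rewrite card_eq eqEsubset edges_sub_sigma1.
Qed.
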